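(* Let $E$ be an $n$-dimensional vector space over a field $\mathbb{F}$ and let $\mathcal{S}$ be a family of subspaces of $E$. Consider the following spanning axiom. (oS4) For all $A,B\in\mathcal{L}(E)$ and $I,J\in\mathcal{L}(E)$ such that $I\in\min(A,\mathcal{S})$ and $J\in\min(B,\mathcal{S})$, there exists $K\in\min(A\cap B,\mathcal{S})$ such that $I\cap J\subseteq K$. If $\mathcal{S}$ satisfies the axioms (S1), (S2) and (oS4), then $\mathcal{S}$ satisfies (S3).
   Context: $n$ is a positive integer, $\mathbb{F}$ is an arbitrary field, and $\mathcal{L}(E)$ denotes the lattice of all subspaces of $E$. For a family $\mathcal{A}\subseteq\mathcal{L}(E)$ and $X\in\mathcal{L}(E)$, $\min(X,\mathcal{A})$ is the set of members of $\mathcal{A}$ containing $X$ that have the smallest dimension among all members of $\mathcal{A}$ containing $X$. Axioms for $\mathcal{S}\subseteq\mathcal{L}(E)$: (S1) $E\in\mathcal{S}$. (S2) For all $I,J\in\mathcal{L}(E)$, if $J\in\mathcal{S}$ and $J\subseteq I$, then $I\in\mathcal{S}$. (S3) For all $I,J\in\mathcal{S}$ such that $\dim J<\dim I$, there exists some $X\in\mathcal{L}(E)$ of codimension $1$ in $E$ satisfying $J\subseteq X$, $I\not\subseteq X$, and $I\cap X\in\mathcal{S}$. *)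

(* Defs.v *)
From mathcomp Require Import all_boot all_order all_algebra.

Set Implicit Arguments.
Unset Strict Implicit.
Unset Printing Implicit Defensive.

Section SpanningAxioms.

Variables (F : fieldType) (E : vectType F).

(* \dim X <= \dim {:E}, so the subtraction does not truncate. *)
Definition codim (X : {vspace E}) : nat := \dim {:E} - \dim X.

(* The set of members of A of smallest dimension among those containing X. *)
Definition minfam (X : {vspace E}) (A : {vspace E} -> Prop) :
    {vspace E} -> Prop :=
  fun Y => [/\ A Y, (X <= Y)%VS
    & forall Z : {vspace E}, A Z -> (X <= Z)%VS -> \dim Y <= \dim Z].

Variable S : {vspace E} -> Prop.

Definition axS1 : Prop := S {:E}%VS.

Definition axS2 : Prop :=
  forall I J : {vspace E}, S J -> (J <= I)%VS -> S I.

Definition axS3 : Prop :=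
  forall I J : {vspace E}, S I -> S J -> \dim J < \dim I ->
  exists X : {vspace E},
    [/\ codim X = 1, (J <= X)%VS, ~~ (I <= X)%VS & S (I :&: X)%VS].

Definition axoS4 : Prop :=
  forall A B I J : {vspace E}, minfam A S I -> minfam B S J ->
  exists2 K : {vspace E}, minfam (A :&: B)%VS S K & (I :&: J <= K)%VS.

End SpanningAxioms.

(* Main.v *)
Require Import Defs.
From mathcomp Require Import all_boot all_order all_algebra.
From mathcomp Require Import zify.
From Stdlib Require Import Classical.

(** Fix [I] and [J] in [S] with [\dim J < \dim I], and look at the subspaces
    [W] for which [I] is a smallest member of [S] containing [W].  They include
    [I] itself, and (oS4), applied with [I] in both of its places, makes them
    closed under intersection ([minfam_cap]).  If (S3) failed for [I] and [J],
    then every trace [I :&: X] on a hyperplane [X] containing [J] but not [I]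
    would be among them: it has codimension one in [I] and is not in [S], so no
    member of [S] containing it is smaller than [I] ([minfam_cap_hyperplane]).
    Such traces suffice to cut [I] down to [I :&: J], since a vector outside
    [J] is always missed by some hyperplane through [J]
    ([hyperplane_avoiding]).  Hence [I] would be a smallest member of [S]
    containing [I :&: J]; but [J] is a smaller one. *)

(** Adding to [U] a complement of [U + <[v]>] gives all of [E] except for the
    direction [v]. *)
Lemma hyperplane_avoiding {F : fieldType} {E : vectType F} {U : {vspace E}}
    {v : E} :
  v \notin U ->
  exists X : {vspace E}, [/\ codim X = 1, (U <= X)%VS & v \notin X].
Proof.
move=> vU; pose V := (U + <[v]>)%VS; exists (U + V^C)%VS.
have ltUV : \dim U < \dim V.
  rewrite (ltn_leqif (dimv_leqif_sup (addvSl U <[v]>))).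
  by rewrite subv_add subvv -memvE.
have full : (U + V^C + <[v]> = fullv)%VS.
  by rewrite -addvA [(V^C + _)%VS]addvC addvA addv_complf.
have dim_le : \dim (U + V^C) < \dim {:E}.
  have [le_sum _] := dimv_add_leqif U V^C.
  have := dimv_compl V; have := dimvS (subvf V); lia.
have dim_ge : \dim {:E} <= \dim (U + V^C) + 1.
  rewrite -full; have [le_sum _] := dimv_add_leqif (U + V^C) <[v]>.
  by apply: leq_trans le_sum _; rewrite leq_add2l dim_vline leq_b1.
split; [by rewrite /codim; lia | exact: addvSl |].
apply/negP => vX; move: full dim_le.
by rewrite (addv_idPl vX) => ->; rewrite ltnn.
Qed.

(** A member of [S] containing [I :&: X] and smaller than [I] would have to be
    [I :&: X] itself, which has codimension at most one in [I]. *)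
Lemma minfam_cap_hyperplane {F : fieldType} {E : vectType F}
    {S : {vspace E} -> Prop} {I X : {vspace E}} :
  codim X = 1 -> S I -> ~ S (I :&: X)%VS -> minfam (I :&: X) S I.
Proof.
rewrite /codim => codimX SI nSIX; split=> // [|Z SZ IXZ]; first exact: capvSl.
rewrite leqNgt; apply/negP => ltZI; apply: nSIX.
suff -> : (I :&: X)%VS = Z by [].
apply/eqP; rewrite eqEdim IXZ /=.
have := dimv_sum_cap I X; have := dimvS (subvf (I + X)); lia.
Qed.

(** The member of [S] that (oS4) provides contains [I :&: I], hence has at
    least the dimension of [I]; so [I] is as small as it. *)
Lemma minfam_cap {F : fieldType} {E : vectType F} {S : {vspace E} -> Prop}
    {A B I : {vspace E}} :
  axoS4 S -> minfam A S I -> minfam B S I -> minfam (A :&: B) S I.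
Proof.
move=> oS4 minA minB; have [K [_ _ minK]] := oS4 _ _ _ _ minA minB.
rewrite capvv => /dimvS leIK; case: minA => SI AI _.
split=> // [|Z SZ ABZ]; first exact: subv_trans (capvSl A B) AI.
exact: leq_trans leIK (minK Z SZ ABZ).
Qed.

Theorem theorem18 (n : nat) (n_gt0 : 0 < n) (F : fieldType) (E : vectType F)
    (dimE : \dim {:E} = n) (S : {vspace E} -> Prop)
    (hS1 : axS1 S) (hS2 : axS2 S) (hoS4 : axoS4 S) : axS3 S.
Proof.
move=> I J SI SJ ltJI.
(* Descend through subspaces W having I as a smallest member of S above them;
   such a W never lies inside J, because J itself belongs to S and is smaller
   than I, so only finding the hyperplane X can end the descent. *)
suff descent d (W : {vspace E}) : \dim W < d -> minfam W S I ->
    exists X : {vspace E},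
      [/\ codim X = 1, (J <= X)%VS, ~~ (I <= X)%VS & S (I :&: X)%VS].
  by apply: (descent _ I (ltnSn _)); split=> // Z _ /dimvS.
elim: d W => // d IHd W ltWd minW; have [_ WI minI] := minW.
have /subvPn[v vW vJ] : ~~ (W <= J)%VS.
  by apply/negP => WJ; have := minI J SJ WJ; rewrite leqNgt ltJI.
have [X [codimX JX vX]] := hyperplane_avoiding vJ.
have [SIX | nSIX] := classic (S (I :&: X)%VS).
  exists X; split=> //; apply/subvPn; exists v => //.
  exact: subvP WI v vW.
apply: (IHd (W :&: (I :&: X))%VS); last first.
  exact: minfam_cap minW (minfam_cap_hyperplane codimX SI nSIX).
apply: (leq_trans _ (ltWd : \dim W <= d)).
rewrite (ltn_leqif (dimv_leqif_sup (capvSl _ _))).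
by apply/subvPn; exists v => //; rewrite !memv_cap (negPf vX) !andbF.
Qed.
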